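(* Let $m\ge 3$, $\mu=\frac m2-1$ and $k\in\mathbb{N}=\{0,1,2,\dots\}$. Let $K_{k+1}^m(x,y)=\frac{k+1+\mu}{\mu}|x|^{k+1}|y|^{k+1}C_{k+1}^\mu(t)$, with $t=\frac{\langle x,y\rangle}{|x||y|}$, be the reproducing kernel of spherical harmonics of degree $k+1$. Applying the Dirac operator $\partial_{\underline{x}}$ from the left and $\partial_{\underline{y}}$ from the right yields $$\partial_{\underline{x}}K_{k+1}^m(x,y)\partial_{\underline{y}}=-(m+2k)^2\Big(\frac{2\mu+k}{2\mu}|x|^k|y|^kC_k^\mu(t)+\underline{x}\wedge\underline{y}\,|x|^{k-1}|y|^{k-1}C_{k-1}^{\mu+1}(t)\Big).$$
   Context: $\mathcal{C}\ell_m$ is the Clifford algebra (with complex coefficients) generated by an orthonormal basis $e_1,\dots,e_m$ of $\mathbb{R}^m$ with $e_je_k+e_ke_j=-2\delta_{jk}$. For $x,y\in\mathbb{R}^m$: $\langle x,y\rangle=\sum_j x_jy_j$, $|x|=\sqrt{\langle x,x\rangle}$, $\underline{x}=\sum_{j=1}^m e_jx_j$, and $\underline{x}\wedge\underline{y}=\sum_{j<k}e_je_k(x_jy_k-x_ky_j)$, so that $\underline{x}\,\underline{y}=\underline{x}\wedge\underline{y}-\langle x,y\rangle$. The Dirac operator is $\partial_{\underline{x}}=\sum_{j=1}^me_j\partial_{x_j}$; acting from the right, $f\partial_{\underline{x}}=\sum_j(\partial_{x_j}f)e_j$. $C_k^\mu$ is the Gegenbauer polynomial $C_k^\mu(t)=\sum_{j=0}^{\lfloor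 k/2\rfloor}(-1)^j\frac{\Gamma(k-j+\mu)}{\Gamma(\mu)j!(k-2j)!}(2t)^{k-2j}$, with $C_k^\mu=0$ for negative $k$. The expressions $|x|^k|y|^kC_k^\mu(t)$ are polynomials in $x,y$ (for $k\ge 0$). *)

(* Defs.v *)
From HB Require Import structures.
From mathcomp Require Import all_boot all_order all_algebra.

Set Implicit Arguments.
Unset Strict Implicit.
Unset Printing Implicit Defensive.

Import Order.TTheory GRing.Theory Num.Theory.

Local Open Scope ring_scope.

(* The Clifford algebra with generators e_0, ..., e_(m-1) subject to            *)
(* e_j e_k + e_k e_j = -2 delta_jk. An element is the family of its coordinates *)
(* on the 2^m ordered monomials e_A = e_(i_1) ... e_(i_r), where                *)
(* A = {i_1 < ... < i_r}. Sorting e_A e_B costs a factor -1 for every pair      *)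
(* (i, j) in A x B with j < i, and e_i e_i = -1 costs another one for every     *)
(* pair with j = i; hence e_A e_B = cl_sign A B * e_(A symmetric difference B). *)
Definition clifford (F : comNzRingType) (m : nat) := {ffun {set 'I_m} -> F^o}.

HB.instance Definition _ (F : comNzRingType) m :=
  GRing.Lmodule.copy (clifford F m) {ffun {set 'I_m} -> F^o}.

Section CliffordRing.
Variables (F : comNzRingType) (m : nat).
Implicit Types (A B C D : {set 'I_m}) (a b c : clifford F m).

Definition symdiff A B : {set 'I_m} := [set i | (i \in A) (+) (i \in B)].

Definition cl_sign A B : F :=
  \prod_(i in A) \prod_(j in B) (if (j <= i)%N then -1 else 1).

Definition cl_basis A : clifford F m := [ffun B => (A == B)%:R].

Definition cl_mul a b : clifford F m :=
  [ffun D => \sum_A \sum_(B | symdiff A B == D) cl_sign A B * (a A * b B)].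

Lemma symdiffC A B : symdiff A B = symdiff B A.
Proof. by apply/setP => i; rewrite !inE addbC. Qed.

Lemma symdiffA A B C : symdiff A (symdiff B C) = symdiff (symdiff A B) C.
Proof. by apply/setP => i; rewrite !inE addbA. Qed.

Lemma symdiff0 A : symdiff A set0 = A.
Proof. by apply/setP => i; rewrite !inE addbF. Qed.

Lemma symdiffKl A B : symdiff A (symdiff A B) = B.
Proof. by apply/setP => i; rewrite !inE addKb. Qed.

Lemma symdiff_eq A B D : (symdiff A B == D) = (B == symdiff A D).
Proof. by apply/eqP/eqP => [<-|->]; rewrite symdiffKl. Qed.

Lemma prod_symdiff (f : 'I_m -> F) A B : (forall i, f i * f i = 1) ->
  \prod_(i in symdiff A B) f i = \prod_(i in A) f i * \prod_(i in B) f i.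
Proof.
move=> ff; rewrite [LHS]big_mkcond [X in X * _]big_mkcond.
rewrite [X in _ * X]big_mkcond -big_split; apply: eq_bigr => i _ /=.
by rewrite inE; case: (i \in A); case: (i \in B); rewrite /= ?mulr1 ?mul1r ?ff.
Qed.

Let sgn_sqr (b : bool) : (if b then -1 else 1 : F) * (if b then -1 else 1) = 1.
Proof. by case: b; rewrite ?mulrNN mulr1. Qed.

Lemma cl_signDr A B C : cl_sign A (symdiff B C) = cl_sign A B * cl_sign A C.
Proof.
by rewrite /cl_sign -big_split; apply: eq_bigr => i _; rewrite prod_symdiff.
Qed.

Lemma cl_signDl A B C : cl_sign (symdiff A B) C = cl_sign A C * cl_sign B C.
Proof.
rewrite /cl_sign prod_symdiff // => i.
by rewrite -big_split big1 // => j _ /=.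
Qed.

Lemma cl_sign0l A : cl_sign set0 A = 1.
Proof. by rewrite /cl_sign big_set0. Qed.

Lemma cl_sign0r A : cl_sign A set0 = 1.
Proof. by rewrite /cl_sign big1 // => i _; rewrite big_set0. Qed.

Lemma cl_mulE a b D :
  cl_mul a b D
  = \sum_A cl_sign A (symdiff A D) * (a A * b (symdiff A D) : F).
Proof.
rewrite ffunE; apply: eq_bigr => A _.
by rewrite (eq_bigl (pred1 (symdiff A D))) ?big_pred1_eq // => B; apply: symdiff_eq.
Qed.

Lemma cl_addE a b D : (a + b) D = a D + b D.
Proof. by rewrite ffunE. Qed.

Lemma cl_scaleE (s : F) a D : (s *: a) D = s * a D.
Proof. by rewrite ffunE. Qed.

Fact cl_mulA : associative cl_mul.
Proof.
move=> a b c; apply/ffunP => D; rewrite !cl_mulE.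
under eq_bigr do rewrite cl_mulE mulr_sumr mulr_sumr.
under [RHS]eq_bigr do rewrite cl_mulE mulr_suml mulr_sumr.
rewrite [RHS]exchange_big; apply: eq_bigr => A _ /=.
rewrite [RHS](reindex_inj (can_inj (symdiffKl A))) /=.
apply: eq_bigr => B _; rewrite symdiffKl.
have -> : symdiff (symdiff A B) D = symdiff B (symdiff A D).
  by rewrite (symdiffC A) symdiffA.
set E := symdiff B (symdiff A D).
have -> : symdiff A D = symdiff B E by rewrite symdiffKl.
rewrite cl_signDr cl_signDl -!mulrA.
set p := cl_sign A B; set q := cl_sign A E; set r := cl_sign B E.
by rewrite [a A * (r * _)]mulrCA [LHS]mulrCA [p * (r * _)]mulrCA.
Qed.

Fact cl_mul1r : left_id (cl_basis set0) cl_mul.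
Proof.
move=> a; apply/ffunP => D; rewrite cl_mulE (bigD1 set0) //=.
rewrite big1 => [|A A0]; last by rewrite ffunE eq_sym (negPf A0) mul0r mulr0.
by rewrite cl_sign0l ffunE eqxx symdiffC symdiff0 !mul1r addr0.
Qed.

Fact cl_mulr1 : right_id (cl_basis set0) cl_mul.
Proof.
move=> a; apply/ffunP => D; rewrite cl_mulE (bigD1 D) //=.
have DD : symdiff D D = set0 by apply/setP => i; rewrite !inE addbb.
rewrite big1 => [|A AD].
  by rewrite DD cl_sign0r ffunE eqxx mulr1 mul1r addr0.
rewrite ffunE; case: eqP => [E|]; last by rewrite !mulr0.
by case/eqP: AD; rewrite -(symdiff0 A) E symdiffKl.
Qed.

Fact cl_mulDl : left_distributive cl_mul +%R.
Proof.
move=> a b c; apply/ffunP => D; rewrite cl_addE !cl_mulE -big_split.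
by apply: eq_bigr => A _; rewrite cl_addE mulrDl mulrDr.
Qed.

Fact cl_mulDr : right_distributive cl_mul +%R.
Proof.
move=> a b c; apply/ffunP => D; rewrite cl_addE !cl_mulE -big_split.
by apply: eq_bigr => A _; rewrite cl_addE !mulrDr.
Qed.

Fact cl_oner_neq0 : cl_basis set0 != 0.
Proof.
apply/eqP => /ffunP/(_ set0); rewrite !ffunE eqxx => /eqP.
by rewrite oner_eq0.
Qed.

HB.instance Definition _ := GRing.Zmodule_isNzRing.Build (clifford F m)
  cl_mulA cl_mul1r cl_mulr1 cl_mulDl cl_mulDr cl_oner_neq0.

Fact cl_scalerAl (s : F) (a b : clifford F m) : s *: (a * b) = (s *: a) * b.
Proof.
apply/ffunP => D; rewrite cl_scaleE [cl_mul _ _ _]cl_mulE [RHS]cl_mulE mulr_sumr.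
by apply: eq_bigr => A _; rewrite cl_scaleE -!mulrA [LHS]mulrCA.
Qed.

HB.instance Definition _ :=
  GRing.Lmodule_isLalgebra.Build F (clifford F m) cl_scalerAl.

Fact cl_scalerAr (s : F) (a b : clifford F m) : s *: (a * b) = a * (s *: b).
Proof.
apply/ffunP => D; rewrite cl_scaleE [cl_mul _ _ _]cl_mulE [RHS]cl_mulE mulr_sumr.
by apply: eq_bigr => A _; rewrite cl_scaleE [LHS]mulrCA; congr (_ * _); rewrite mulrCA.
Qed.

HB.instance Definition _ :=
  GRing.Lalgebra_isAlgebra.Build F (clifford F m) cl_scalerAr.

Definition cl_gen (j : 'I_m) : clifford F m := cl_basis [set j].

Lemma cl_basisM A B :
  cl_basis A * cl_basis B = cl_sign A B *: cl_basis (symdiff A B).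
Proof.
apply/ffunP => D; rewrite [LHS]cl_mulE (bigD1 A) //= big1 => [|A' A'A].
  rewrite cl_scaleE !ffunE eqxx mul1r addr0 -symdiff_eq.
  by case: eqP => [<-|_]; rewrite ?symdiffKl ?mulr0.
by rewrite ffunE eq_sym (negPf A'A) mul0r mulr0.
Qed.

Lemma cl_gen_relation (j k : 'I_m) :
  cl_gen j * cl_gen k + cl_gen k * cl_gen j = - (j == k)%:R *+ 2.
Proof.
rewrite /cl_gen !cl_basisM (symdiffC [set k]) /cl_sign !big_set1.
case: (ltngtP j k) => [jk|kj|/val_inj jk].
- by rewrite -[j == k]/(val j == val k) ltn_eqF// scaleN1r scale1r subrr oppr0 mul0rn.
- by rewrite -[j == k]/(val j == val k) gtn_eqF// scaleN1r scale1r addNr oppr0 mul0rn.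
- have -> : symdiff [set j] [set k] = set0.
    by rewrite jk; apply/setP => i; rewrite !inE addbb.
  by rewrite jk eqxx scaleN1r mulr2n.
Qed.

Lemma cl_basisE A : cl_basis A = \prod_(i <- enum A) cl_gen i.
Proof.
have prodE (s : seq 'I_m) : sorted (fun i j : 'I_m => (i < j)%N) s ->
    \prod_(i <- s) cl_gen i = cl_basis [set i in s].
  elim: s => [_|i s IHs /= ss].
    by rewrite big_nil; congr cl_basis; apply/setP => j; rewrite !inE.
  have tr : transitive (fun i j : 'I_m => (i < j)%N) by move=> ? ? ?; apply: ltn_trans.
  rewrite big_cons IHs ?(path_sorted ss)// cl_basisM.
  have lts j : j \in s -> (i < j)%N.
    by move: ss; rewrite (path_sortedE tr) => /andP[/allP h _] /h.
  have -> : cl_sign [set i] [set i in s] = 1.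
    by rewrite /cl_sign big_set1 big1 // => j; rewrite inE => /lts; rewrite ltnNge => /negPf->.
  rewrite scale1r; congr cl_basis; apply/setP => j; rewrite !inE.
  by case: eqP => // ->; case: (boolP (i \in s)) => // /lts; rewrite ltnn.
rewrite prodE.
  by congr cl_basis; apply/setP => i; rewrite inE mem_enum.
have -> : enum A = filter (mem A) (enum 'I_m).
  by rewrite [enum 'I_m]enumT.
apply: sorted_filter; first by move=> ? ? ?; apply: ltn_trans.
by have := iota_ltn_sorted 0 m; rewrite -val_enum_ord sorted_map.
Qed.

End CliffordRing.

From mathcomp Require Import all_classical all_reals all_analysis complex.
Import numFieldNormedType.Exports.
Local Open Scope complex_scope.

Section Dirac.
Variables (R : realType) (m : nat).
Implicit Types (x y : 'rV[R]_m) (f : 'rV[R]_m -> clifford R[i] m).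

(* Euclidean; the canonical norm `|x| on 'rV[R]_m is the sup norm. *)
Definition inner x y : R := \sum_(j < m) x 0 j * y 0 j.
Definition enorm x : R := Num.sqrt (inner x x).

Definition cl_real (a : R) : clifford R[i] m := (a%:C)%:A.

Definition wedge x y : clifford R[i] m :=
  \sum_(j < m) \sum_(k < m | (j < k)%N)
    (x 0 j * y 0 k - x 0 k * y 0 j)%:C *: (cl_gen R[i] j * cl_gen R[i] k).

(* Real partial derivative, taken on the real and imaginary part of every       *)
(* coordinate.                                                                  *)
Definition partial (j : 'I_m) f x : clifford R[i] m :=
  [ffun A => ('D_('e_j) (fun z => complex.Re (f z A)) x)
             +i* ('D_('e_j) (fun z => complex.Im (f z A)) x)].

Definition dirac_left f x : clifford R[i] m :=
  \sum_(j < m) cl_gen R[i] j * partial j f x.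

Definition dirac_right f x : clifford R[i] m :=
  \sum_(j < m) partial j f x * cl_gen R[i] j.

End Dirac.

Section Gegenbauer.
Variable R : realType.

Definition Gamma (s : R) : R :=
  \int[lebesgue_measure]_(t in `]0, +oo[%classic) (t `^ (s - 1) * expR (- t)).

Definition gegenbauer (mu : R) (k : int) (t : R) : R :=
  match k with
  | Posz n => \sum_(j < n./2.+1)
      (-1) ^+ j * (Gamma ((n - j)%:R + mu)
                   / (Gamma mu * (j`!)%:R * ((n - j.*2)`!)%:R))
      * (2 * t) ^+ (n - j.*2)
  | Negz _ => 0
  end.

(* |x|^k |y|^k C_k^mu(<x,y> / (|x||y|)). As division by 0 gives 0, the value at *)
(* x = 0 or y = 0 is 0 for k > 0 and C_0^mu = 1 for k = 0, so this is the       *)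
(* polynomial extension in (x, y). For k < 0 it is 0.                           *)
Definition zonal (m : nat) (mu : R) (k : int) (x y : 'rV[R]_m) : R :=
  enorm x ^ k * enorm y ^ k
  * gegenbauer mu k (inner x y / (enorm x * enorm y)).

Definition harmonic_kernel (m k : nat) (x y : 'rV[R]_m) : R :=
  let mu := m%:R / 2 - 1 in (k%:R + mu) / mu * zonal mu k x y.

End Gegenbauer.

(* Main.v *)
Require Import Defs.
From HB Require Import structures.
From mathcomp Require Import all_boot all_order all_algebra.
From mathcomp Require Import all_classical all_reals all_analysis complex.
From mathcomp Require Import measurable_realfun.
From mathcomp Require Import ring lra zify.
Import Order.TTheory GRing.Theory Num.Theory.
Import numFieldNormedType.Exports.
Local Open Scope ring_scope.
Local Open Scope complex_scope.

(** Put s = <x, y>, w = |x|^2 |y|^2 and n = k + 1. Since Gamma (r + 1) = r Gamma r,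
    the Gegenbauer coefficients are rational in mu, and |x|^n |y|^n C_n^mu (t) is the
    polynomial G_n (s, w) = \sum_(i + 2 j = n) g_(i, j) s^i w^j with
    g_(i, j) = (-1)^j (mu)_(i + j) 2^i / (i! j!), where (mu)_r is the rising
    factorial ([zonalE]).

    The kernel is scalar, so applying the Dirac operators on both sides amounts to
    pairing its mixed second derivatives with the products e_j e_i
    ([dirac_left_right]). By the chain rule such a derivative of a function of s and
    w is a combination of delta_(ij), x_i y_j, x_j y_i, x_i x_j and y_i y_j. The
    first one contributes \sum_i e_i^2 = - m and the others the Clifford products of
    the vectors x and y, which are all given by x y = x /\ y - <x, y>. Hence, for a
    function G of s and w, the result is a scalar plus a multiple of x /\ y:
      - (s G_ss + 4 w G_sw + m G_s + 4 s (G_w + w G_ww))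
        + (4 (G_w + w G_ww) - G_ss) x /\ y.
    [sum_zmono_d2] is this formula for a monomial s^a w^b.

    It remains to compare coefficients. With m = 2 mu + 2, the scalar bracket applied
    to G_n is 2 (mu + n) (2 mu + n - 1) times the polynomial G_(n - 1) of the same
    parameter mu, and the factor of x /\ y is - 4 mu (mu + n) times the polynomial
    G_(n - 2) of parameter mu + 1. In terms of the g_(i, j) these are the two-term
    relations [geg_coef_lower] and [geg_coef_raise]. Multiplying by (n + mu) / mu and
    using m + 2 k = 2 (mu + n) gives the two summands of the theorem. *)

(** * The functional equation of the Gamma integral *)

Section GammaFunction.
Context {R : realType}.
Implicit Types a b s t : R.
Local Open Scope classical_set_scope.

Local Notation mu := (@lebesgue_measure R).

Lemma is_derive_expRN (t : R) : is_derive t 1 (fun x => expR (- x)) (- expR (- t)).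
Proof.
rewrite -[- expR _]mulr1 mulNr -mulrN.
exact: (@is_derive1_comp R expR -%R t _ (-1)).
Qed.

Lemma continuous_expRN : continuous (fun t : R => expR (- t)).
Proof.
move=> t; apply: continuous_comp; first exact: opp_continuous.
exact: continuous_expR.
Qed.

Lemma continuous_powRl s t : 0 < t -> {for t, continuous (fun x : R => x `^ s)}.
Proof.
move=> t0; apply: differentiable_continuous; apply/derivable1_diffP.
by apply: ex_derive; exact: is_derive1_powR.
Qed.

Lemma continuous_gamma_integrand s a b : 0 < a ->
  {within `[a, b], continuous (fun t : R => t `^ s * expR (- t))}.
Proof.
move=> a0; apply: continuous_in_subspaceT => t.
rewrite inE/= in_itv/= => /andP[at_ _].
apply: cvgM; last exact: continuous_expRN.
by apply: continuous_powRl; exact: lt_le_trans at_.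
Qed.

(** The functional equation on a compact interval away from 0: the integrand is
    unbounded near 0 when the exponent is negative, so both ends of the half-line
    have to be reached by a limit. *)
Lemma gamma_by_parts s a b : 0 < a -> a < b ->
  (\int[mu]_(t in `[a, b]) (t `^ s * expR (- t))%:E =
   (a `^ s * expR (- a) - b `^ s * expR (- b))%:E +
   s%:E * \int[mu]_(t in `[a, b]) (t `^ (s - 1) * expR (- t))%:E)%E.
Proof.
move=> a0 ab; have b0 := lt_trans a0 ab.
rewrite (@integration_by_parts R (fun x : R => x `^ s) (fun t => - expR (- t))
  (fun t => s * t `^ (s - 1)) (fun t => expR (- t)) a b) //; first last.
- move=> t _; rewrite derive1E.
  have := is_derive_expRN t => ?; rewrite derive_val; exact: opprK.
- split.
  + move=> t _; apply: derivableN; have := is_derive_expRN t => ?; exact: ex_derive.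
  + by apply/cvg_at_right_filter; apply: cvgN; exact: continuous_expRN.
  + by apply/cvg_at_left_filter; apply: cvgN; exact: continuous_expRN.
- by apply: continuous_subspaceT; exact: continuous_expRN.
- move=> t /[!in_itv]/= /andP[at_ _].
  by rewrite powR_derive1// in_itv/= andbT (lt_trans a0).
- split.
  + move=> t /[!in_itv]/= /andP[at_ _]; apply: ex_derive.
    by apply: is_derive1_powR; exact: lt_trans at_.
  + by apply/cvg_at_right_filter; exact: continuous_powRl.
  + by apply/cvg_at_left_filter; exact: continuous_powRl.
- apply: continuous_in_subspaceT => t; rewrite inE/= in_itv/= => /andP[at_ _].
  by apply: cvgM; [exact: cvg_cst|apply: continuous_powRl; exact: lt_le_trans at_].
have opp_mul (u v : R) : (s * u * - v)%:E = ((- s)%:E * (u * v)%:E)%E.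
  by rewrite -EFinM; congr EFin; ring.
under eq_integral => t _ do rewrite opp_mul.
rewrite integralZl//; last first.
  apply: continuous_compact_integrable; first exact: segment_compact.
  exact: continuous_gamma_integrand.
rewrite EFinN mulNe oppeK; congr (_%:E + _)%E; ring.
Qed.

(** The exponential beats every power, because it dominates the single term
    t^(N+1) / (N+1)! of its series, where N >= s. *)
Lemma powR_expRN_le s :
  exists2 c, 0 <= c & forall t, 1 <= t -> t `^ s * expR (- t) <= c * t^-1.
Proof.
pose N := Num.bound `|s|; exists N.+1`!%:R => [//|t t1].
have t0 : 0 < t by exact: lt_le_trans t1.
have sN : t `^ s <= t ^+ N.
  rewrite -powR_mulrn ?(ltW t0)//; apply: ler_powR => //.
  by apply: le_trans (ler_norm s) (ltW _); exact: archi_boundP.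
have tE : t ^+ N.+1 / N.+1`!%:R <= expR t.
  by apply: le_trans (expR_ge1Dxn N (ltW t0)); rewrite lerDr.
rewrite expRN ler_pdivrMr ?expR_gt0//; apply: le_trans sN _.
apply: le_trans (_ : N.+1`!%:R * t^-1 * (t ^+ N.+1 / N.+1`!%:R) <= _).
  rewrite exprS le_eqVlt; apply/orP; left; apply/eqP; field.
  by apply/andP; split; rewrite ?pnatr_eq0 -?lt0n ?fact_gt0 ?gt_eqF.
by rewrite ler_wpM2l// mulr_ge0// invr_ge0 (ltW t0).
Qed.

(** The boundary terms of the integration by parts vanish when the interval
    [1/(n+1), n+2] exhausts the half-line; the end point n+2 makes this interval
    nondegenerate already for n = 0. *)
Lemma gamma_boundary_cvg s : 0 < s ->
  (fun n => n.+1%:R^-1 `^ s * expR (- n.+1%:R^-1)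
            - n.+2%:R `^ s * expR (- n.+2%:R) : R) @ \oo --> (0 : R).
Proof.
move=> s0; rewrite -[X in _ --> X]subr0; apply: cvgB.
  have h0 : (n.+1%:R^-1 : R) @[n --> \oo] --> (0 : R) by exact: cvg_harmonic.
  rewrite -(mul0r (expR (- 0))); apply: cvgM; last first.
    by have := continuous_expRN 0; exact: cvg_comp h0.
  apply: cvg_comp (powR_cvg0 s0).
  move=> A [e /= e0 Ae].
  have [n _ hn] := (cvgr_lt _ h0 _ e0).
  exists n => // k nk; apply: Ae; last by rewrite invr_gt0.
  by rewrite /= sub0r normrN ger0_norm ?invr_ge0//; exact: hn.
have [c c0 cP] := powR_expRN_le s.
apply: (@squeeze_cvgr _ _ _ _ (fun=> 0) (fun n => c * harmonic n)).
- near=> n; rewrite mulr_ge0 ?powR_ge0 ?expR_ge0//=.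
  apply: le_trans (cP _ _) _; first by rewrite ler1n.
  by rewrite ler_wpM2l//= lef_pV2 ?posrE// ler_nat.
- exact: cvg_cst.
- by rewrite -(mulr0 c); apply: cvgM; [exact: cvg_cst|exact: cvg_harmonic].
Unshelve. all: by end_near. Qed.

Lemma bigcup_gamma_itv :
  \bigcup_n `[n.+1%:R^-1, n.+2%:R] = `]0, +oo[ :> set R.
Proof.
apply/seteqP; split => [t [n _]|t] /=; rewrite !in_itv/= ?andbT.
  by case/andP => + _; apply: lt_le_trans; rewrite invr_gt0.
move=> t0; exists (Num.bound t + Num.bound t^-1)%N => //=; rewrite in_itv/=.
have bt : t < (Num.bound t)%:R by apply: archi_boundP; exact: ltW.
have bi : t^-1 < (Num.bound t^-1)%:R by apply: archi_boundP; rewrite invr_ge0 (ltW t0).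
apply/andP; split.
  rewrite invf_ple ?posrE//; apply: le_trans (ltW bi) _.
  by rewrite ler_nat; lia.
by apply: le_trans (ltW bt) _; rewrite ler_nat; lia.
Qed.

Lemma gamma_cvg s :
  (\int[mu]_(t in `[(n.+1%:R^-1)%R, n.+2%:R%R]) (t `^ s * expR (- t))%:E)%E @[n --> \oo]
  --> (\int[mu]_(t in `]0%R, +oo[) (t `^ s * expR (- t))%:E)%E.
Proof.
rewrite -bigcup_gamma_itv; apply: ge0_nondecreasing_set_cvg_integral.
- move=> m n mn; apply/subsetPset; apply: subset_itv; rewrite bnd_simp.
    by rewrite lef_pV2 ?posrE// ler_nat.
  by rewrite ler_nat.
- by move=> n; exact: measurable_itv.
- move=> n; apply/measurable_EFinP; apply: measurable_funM.
    by apply: measurable_funTS; exact: measurable_powR.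
  apply: measurable_funTS; apply: continuous_measurable_fun; exact: continuous_expRN.
- by move=> n t _; rewrite lee_fin mulr_ge0 ?powR_ge0 ?expR_ge0.
Qed.

(** The value Gamma (s + 1), before it is known to be finite. *)
Definition gamma_integral s : \bar R :=
  (\int[mu]_(t in `]0%R, +oo[) (t `^ s * expR (- t))%:E)%E.
Local Notation I := gamma_integral.

Let f s t : R := t `^ s * expR (- t).

Let f_ge0 s t : 0 <= f s t.
Proof. by rewrite mulr_ge0 ?powR_ge0 ?expR_ge0. Qed.

Let measurable_f s : measurable_fun (`]0, +oo[ : set R) (fun t => (f s t)%:E).
Proof.
apply/measurable_EFinP; apply: measurable_funM.
  by apply: measurable_funTS; exact: measurable_powR.
by apply: measurable_funTS; apply: continuous_measurable_fun; exact: continuous_expRN.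
Qed.

Let I_ge0 s : (0 <= I s)%E.
Proof. by apply: integral_ge0 => t _; rewrite lee_fin f_ge0. Qed.

Lemma gamma_integral_rec s : 0 < s -> I s = (s%:E * I (s - 1)%R)%E.
Proof.
move=> s0.
pose J r n := (\int[mu]_(t in `[(n.+1%:R^-1)%R, n.+2%:R%R]) (t `^ r * expR (- t))%:E)%E.
have JE : J s = fun n => ((n.+1%:R^-1 `^ s * expR (- n.+1%:R^-1) -
    n.+2%:R `^ s * expR (- n.+2%:R))%:E + s%:E * J (s - 1)%R n)%E.
  apply/funext => n; apply: gamma_by_parts; first by rewrite invr_gt0.
  by apply: (@le_lt_trans _ _ 1); rewrite ?invf_le1 ?ler1n ?ltr1n.
have Js : J s @ \oo --> I s by exact: gamma_cvg.
apply: (cvg_unique _ Js) => //=.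
rewrite JE -[X in _ --> X]add0e; apply: cvgeD.
- by rewrite fin_num_adde_defr.
- by apply: cvg_EFin; [exact: nearW|exact: gamma_boundary_cvg].
- by apply: cvgeZl => //; exact: gamma_cvg.
Qed.

Lemma gamma_integral0 : I 0 = 1%E.
Proof.
rewrite /I; under eq_integral => t _ do rewrite powRr0 mul1r.
rewrite integral_itv_obnd_cbnd; last first.
  apply/measurable_EFinP; apply: measurable_funTS.
  by apply: continuous_measurable_fun; exact: continuous_expRN.
rewrite (@ge0_continuous_FTC2y R _ (fun t => - expR (- t)) 0 0).
- by rewrite oppr0 expR0 -EFinB sub0r opprK.
- by move=> t _; exact: expR_ge0.
- by apply: continuous_subspaceT; exact: continuous_expRN.
- by rewrite -[X in _ --> X]oppr0; apply: cvgN; exact: cvgr_expR.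
- by move=> t _; apply: derivableN; have := is_derive_expRN t => ?; exact: ex_derive.
- by apply/cvg_at_right_filter; apply: cvgN; exact: continuous_expRN.
- move=> t _; rewrite derive1E; have := is_derive_expRN t => ?.
  by rewrite derive_val; exact: opprK.
Qed.

Lemma gamma_integral_nat n : I n%:R = (n`!)%:R%:E.
Proof.
elim: n => [|n IHn]; first by rewrite gamma_integral0.
by rewrite gamma_integral_rec// -natr1 addrK IHn -EFinM natr1 -natrM.
Qed.

(** Pointwise, t^b <= t^a for t <= 1 and t^b <= t^c for t >= 1. Together with
    the explicit values at the natural numbers, this yields both the finiteness and
    the positivity of the integral at every exponent above -1. *)
Lemma gamma_integral_interp a b c : a <= b <= c -> (I b <= I a + I c)%E.
Proof.
move=> /andP[ab bc].
have D t : (`]0, +oo[ : set R) t -> 0 < t by rewrite /= in_itv/= andbT.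
have f0 r t : (`]0, +oo[ : set R) t -> (0 <= (f r t)%:E)%E by rewrite lee_fin f_ge0.
rewrite /I -ge0_integralD//; [|exact: f0|exact: measurable_f
                                |exact: f0|exact: measurable_f].
apply: ge0_le_integral => //.
- by move=> t _; rewrite lee_fin f_ge0.
- exact: measurable_f.
- exact: (emeasurable_funD (measurable_f a) (measurable_f c)).
move=> t /D t0; rewrite -EFinD lee_fin -mulrDl ler_wpM2r ?expR_ge0//.
have [t1|t1] := leP t 1.
  by rewrite (le_trans (ger_powR _ ab)) ?t0// lerDl powR_ge0.
by rewrite (le_trans (ler_powR (ltW t1) bc))// lerDr powR_ge0.
Qed.

Lemma gamma_integral_fin s : -1 < s -> (I s < +oo)%E.
Proof.
have pos r : 0 < r -> (I r < +oo)%E.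
  move=> r0; apply: le_lt_trans (@gamma_integral_interp 0 r (Num.bound r)%:R _) _.
    by rewrite (ltW r0) ltW//; apply: archi_boundP; exact: ltW.
  by rewrite (gamma_integral_nat 0) gamma_integral_nat -EFinD ltry.
(* The recursion, read backwards, transfers finiteness from s + 1 to s. *)
move=> s1; have s10 : 0 < s + 1 by rewrite -ltrBlDr sub0r.
have := pos _ s10; rewrite gamma_integral_rec// addrK.
have := I_ge0 s; case: (I s) => [r|//|//] _; first by move=> _; rewrite ltry.
by rewrite gt0_muley.
Qed.

(** If the integral vanished at s, it would vanish at all s + n by the recursion,
    hence, by interpolation, at the natural numbers in between, where it is a
    factorial. *)
Lemma gamma_integral_gt0 s : -1 < s -> (0%R < I s)%E.
Proof.
move=> s1; rewrite lt0e I_ge0 andbT; apply/eqP => I0.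
have In n : I (s + n%:R) = 0%E.
  elim: n => [|n IHn]; first by rewrite addr0.
  rewrite gamma_integral_rec -natr1.
    by rewrite addrA addrK IHn mule0.
  by rewrite addrA; have : 0 <= n%:R :> R by []; lra.
pose N := Num.bound `|s|.
have sN : `|s| < N%:R by apply: archi_boundP.
have : (I N%:R <= I s + I (s + (N + N)%:R))%E.
  apply: gamma_integral_interp; move: sN; rewrite natrD ltr_norml => /andP[].
  by lra.
by rewrite In I0 adde0 gamma_integral_nat lee_fin leNgt ltr0n fact_gt0.
Qed.

Lemma Gamma_gt0 s : 0 < s -> 0 < Gamma s.
Proof.
move=> s0; have s1 : -1 < s - 1 by lra.
by apply: fine_gt0; rewrite gamma_integral_gt0// gamma_integral_fin.
Qed.

Lemma GammaS s : 0 < s -> Gamma (s + 1) = s * Gamma s.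
Proof.
move=> s0; have s1 : -1 < s - 1 by lra.
rewrite /Gamma /Rintegral addrK [X in fine X = _]gamma_integral_rec//.
rewrite fineM// ge0_fin_numE ?I_ge0//; exact: gamma_integral_fin.
Qed.

End GammaFunction.

(** * Products of vectors in the Clifford algebra *)

Section CliffordVectors.
Context {R : realType} {m : nat}.
Implicit Types x y : 'rV[R]_m.

Local Notation e j := (cl_gen R[i] j).

Definition cl_vector x : clifford R[i] m := \sum_(j < m) (x 0 j)%:C *: e j.

Lemma innerC x y : inner x y = inner y x.
Proof. by apply: eq_bigr => j _; rewrite mulrC. Qed.

Lemma wedgeC x y : wedge y x = - wedge x y.
Proof.
rewrite /wedge -sumrN; apply: eq_bigr => j _; rewrite -sumrN.
apply: eq_bigr => k _.
rewrite -[RHS]scaleNr -rmorphN.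
by congr (_%:C *: _); ring.
Qed.

Lemma wedgexx x : wedge x x = 0.
Proof.
rewrite /wedge big1// => j _; rewrite big1// => k _.
by rewrite [x 0 j * _]mulrC subrr scale0r.
Qed.

Lemma cl_gen_sqr (j : 'I_m) : e j * e j = -1.
Proof.
rewrite /cl_gen cl_basisM /cl_sign !big_set1 leqnn scaleN1r; congr (- _).
by congr cl_basis; apply/setP => k; rewrite !inE addbb.
Qed.

Lemma cl_gen_anti (j k : 'I_m) : j != k -> e k * e j = - (e j * e k).
Proof.
move=> jk; have := cl_gen_relation R[i] j k; rewrite (negbTE jk) oppr0 mul0rn.
by move/eqP; rewrite addrC addr_eq0 => /eqP.
Qed.

Lemma cl_vectorM_sum x y : cl_vector x * cl_vector y =
  \sum_(j < m) \sum_(k < m) (x 0 j * y 0 k)%:C *: (e j * e k).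
Proof.
rewrite mulr_suml; apply: eq_bigr => j _; rewrite mulr_sumr.
apply: eq_bigr => k _.
by rewrite -scalerAl -scalerAr scalerA -rmorphM.
Qed.

(** The diagonal terms give - <x, y> because e_j^2 = -1; the terms (j, k) and
    (k, j) combine because e_k e_j = - e_j e_k. *)
Lemma cl_vectorM x y :
  cl_vector x * cl_vector y = wedge x y - (inner x y)%:C%:A.
Proof.
pose F (j k : 'I_m) := (x 0 j * y 0 k)%:C *: (e j * e k).
rewrite cl_vectorM_sum -/(F _ _).
have -> : \sum_(j < m) \sum_(k < m) F j k =
  \sum_(j < m) (\sum_(k < m | (j < k)%N) F j k
                + \sum_(k < m | (k < j)%N) F j k + F j j).
  apply: eq_bigr => j _; rewrite (bigD1 j)//= addrC; congr (_ + _).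
  rewrite (bigID (fun k : 'I_m => (j < k)%N))/=; congr (_ + _); apply: eq_bigl => k.
    by rewrite andb_idl// -val_eqE/=; case: ltngtP.
  by rewrite -val_eqE/= -leqNgt; case: ltngtP.
rewrite !big_split/=; congr (_ + _); last first.
  rewrite /inner rmorph_sum/= scaler_suml -sumrN; apply: eq_bigr => j _.
  by rewrite /F cl_gen_sqr scalerN.
rewrite [X in _ + X](exchange_big_dep predT)//= -big_split/=; apply: eq_bigr => j _.
rewrite -big_split/=; apply: eq_bigr => k jk.
rewrite /F (@cl_gen_anti j k); last by rewrite -val_eqE/=; case: ltngtP jk.
by rewrite scalerN -scalerBl -rmorphB.
Qed.

End CliffordVectors.

(** * Partial derivatives and the two Dirac operators *)

Section Derivatives.
Local Open Scope classical_set_scope.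
Context {R : realType}.

(** This covers <x, y> and |x|^2, whose restrictions to a line are polynomials of
    degree at most 2, without any continuity argument on vectors. *)
Lemma is_derive_quadratic (V : normedModType R) (f : V -> R) (x v : V) (c d : R) :
  (forall h, f (h *: v + x) = f x + h * (c + h * d)) -> is_derive x v f c.
Proof.
move=> fE.
have cvg_c : (fun h : R => h^-1 *: ((f \o shift x) (h *: v) - f x)) @ 0^' --> c.
  have H : (fun h : R => c + h * d) @ 0^' --> c.
    rewrite -[X in _ --> X]addr0 -[X in _ + X](mul0r d).
    apply: cvgD; first exact: cvg_cst.
    apply: cvgM; last exact: cvg_cst.
    exact: nbhs_dnbhs.
  apply: cvg_trans H; apply: near_eq_cvg; near=> h.
  have h0 : h != 0 by near: h; exact: nbhs_dnbhs_neq.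
  by rewrite /= fE [f x + _]addrC addrK [_ *: _]mulrA mulVf// mul1r.
by apply: DeriveDef; [apply/cvg_ex; exists c|exact: cvg_lim].
Unshelve. all: by end_near. Qed.

(** The predecessors are harmless: when an exponent is 0, the term in which it is
    decreased carries the factor 0. *)
Lemma is_derive_monomial {V : normedModType R} {s w : V -> R} {x v : V}
    {ds dw : R} a b :
  is_derive x v s ds -> is_derive x v w dw ->
  is_derive x v (fun z => s z ^+ a * w z ^+ b)
    (a%:R * ds * (s x ^+ a.-1 * w x ^+ b) + b%:R * dw * (s x ^+ a * w x ^+ b.-1)).
Proof.
move=> sd wd.
have -> : (fun z => s z ^+ a * w z ^+ b) = s ^+ a * w ^+ b.
  by apply/funext => z; rewrite !fctE.
apply: is_derive_eq; rewrite !fctE /GRing.scale/=; ring.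
Qed.

End Derivatives.

Section Inner.
Context {R : realType} {m : nat}.
Implicit Types x y z v : 'rV[R]_m.

Lemma innerDl x y z h : inner (h *: x + y) z = inner y z + h * inner x z.
Proof.
rewrite /inner mulr_sumr -big_split; apply: eq_bigr => j _ /=.
by rewrite !mxE; ring.
Qed.

Lemma inner_delta (j : 'I_m) y : inner 'e_j y = y 0 j.
Proof.
rewrite /inner (bigD1 j)//= big1 ?addr0 => [|k kj]; rewrite mxE ?eqxx ?mul1r//.
by rewrite (negbTE kj) mul0r.
Qed.

Lemma is_derive_innerl x y v : is_derive x v (fun z => inner z y) (inner v y).
Proof.
by apply: (@is_derive_quadratic _ _ _ _ _ _ 0) => h; rewrite innerDl mulr0 addr0.
Qed.

Lemma is_derive_innerxx x v : is_derive x v (fun z => inner z z) (2 * inner x v).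
Proof.
apply: (@is_derive_quadratic _ _ _ _ _ _ (inner v v)) => h.
rewrite innerDl !(innerC _ (h *: v + x)) !innerDl (innerC v x); ring.
Qed.

End Inner.

Section PartialDerivatives.
Context {R : realType} {m : nat}.
Implicit Types x y : 'rV[R]_m.

(** The basis elements b_l have complex coordinates, so the real and imaginary
    parts of a coordinate are real linear combinations of the f_l. *)
Lemma partial_scale_sum n (f : 'I_n -> 'rV[R]_m -> R) (df : 'I_n -> R)
    (b : 'I_n -> clifford R[i] m) (j : 'I_m) x :
  (forall l, is_derive x 'e_j (f l) (df l)) ->
  partial j (fun z => \sum_(l < n) (f l z)%:C *: b l) x
  = \sum_(l < n) (df l)%:C *: b l.
Proof.
move=> fd; apply/ffunP => A; rewrite ffunE.
have ReE : (fun z => complex.Re ((\sum_(l < n) (f l z)%:C *: b l) A))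
    = \sum_(l < n) (f l * cst (complex.Re (b l A))).
  apply/funext => z; rewrite sum_ffunE raddf_sum fct_sumE; apply: eq_bigr => l _.
  by rewrite cl_scaleE fctE; case: (b l A) => u v /=; rewrite mul0r subr0.
have ImE : (fun z => complex.Im ((\sum_(l < n) (f l z)%:C *: b l) A))
    = \sum_(l < n) (f l * cst (complex.Im (b l A))).
  apply/funext => z; rewrite sum_ffunE raddf_sum fct_sumE; apply: eq_bigr => l _.
  by rewrite cl_scaleE fctE; case: (b l A) => u v /=; rewrite mul0r addr0.
have dE (c : 'I_n -> R) :
    'D_('e_j) (\sum_(l < n) (f l * cst (c l))) x = \sum_(l < n) df l * c l.
  rewrite derive_val; apply: eq_bigr => l _.
  by rewrite scaler0 add0r mulrC.
rewrite ReE ImE !dE sum_ffunE; apply/eqP; rewrite eq_complex/= !raddf_sum/=.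
by apply/andP; split; apply/eqP; apply: eq_bigr => l _; rewrite cl_scaleE;
  case: (b l A) => u v /=; rewrite mul0r ?subr0 ?addr0.
Qed.

(** The products appear as e_j e_i because the x-derivative, of index j, puts its
    generator on the left and the y-derivative, of index i, on the right. *)
Lemma dirac_left_right (K : 'rV[R]_m -> 'rV[R]_m -> R)
    (D : 'I_m -> 'rV[R]_m -> 'rV[R]_m -> R) (H : 'I_m -> 'I_m -> R) x y :
  (forall j y', is_derive x 'e_j (K ^~ y') (D j x y')) ->
  (forall i j, is_derive y 'e_i (D j x) (H i j)) ->
  dirac_right (fun y' => dirac_left (fun x' => cl_real m (K x' y')) x) y
  = \sum_(i < m) \sum_(j < m) (H i j)%:C *: (cl_gen R[i] j * cl_gen R[i] i).
Proof.
move=> KD DH.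
have -> : (fun y' => dirac_left (fun x' => cl_real m (K x' y')) x) =
    fun y' => \sum_(j < m) (D j x y')%:C *: cl_gen R[i] j.
  apply/funext => y'; apply: eq_bigr => j _.
  have -> : (fun x' => cl_real m (K x' y')) =
     (fun x' => \sum_(l < 1) (K x' y')%:C *: 1).
    by apply/funext => x'; rewrite big_ord1.
  rewrite (@partial_scale_sum 1 (fun _ => K ^~ y') (fun _ => D j x y'))// big_ord1.
  by rewrite -scalerAr mulr1.
apply: eq_bigr => i _.
rewrite (@partial_scale_sum m (fun j => D j x) (H i))// mulr_suml.
by apply: eq_bigr => j _; rewrite -scalerAl.
Qed.

End PartialDerivatives.

(** * The Dirac operators on monomials in <x, y> and |x|^2 |y|^2 *)

Section ZonalMonomials.
Context {R : realType} {m : nat}.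
Implicit Types (x y : 'rV[R]_m) (a b : nat).

Definition zmono a b x y : R := inner x y ^+ a * (inner x x * inner y y) ^+ b.

(** The derivatives of [zmono] in x_j, in y_i, and in both; see [is_derive_zmonol],
    [is_derive_zmonor] and [is_derive_zmono_dl]. *)
Definition zmono_dl a b (j : 'I_m) x y : R :=
  a%:R * y 0 j * zmono a.-1 b x y
  + 2 * b%:R * x 0 j * (inner y y * zmono a b.-1 x y).

Definition zmono_dr a b (i : 'I_m) x y : R :=
  a%:R * x 0 i * zmono a.-1 b x y
  + 2 * b%:R * y 0 i * (inner x x * zmono a b.-1 x y).

Definition zmono_d2 a b (i j : 'I_m) x y : R :=
  a%:R * ((i == j)%:R * zmono a.-1 b x y + y 0 j * zmono_dr a.-1 b i x y)
  + 2 * b%:R * x 0 j * (2 * y 0 i * zmono a b.-1 x y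
                        + inner y y * zmono_dr a b.-1 i x y).

Lemma zmonoC a b x y : zmono a b x y = zmono a b y x.
Proof. by rewrite /zmono innerC [X in _ * X ^+ _]mulrC. Qed.

Lemma is_derive_zmonol a b j x y :
  is_derive x 'e_j (fun z => zmono a b z y) (zmono_dl a b j x y).
Proof.
have dw : is_derive x 'e_j (fun z => inner z z * inner y y) (2 * x 0 j * inner y y).
  have := is_derive_innerxx x 'e_j; rewrite (innerC x) inner_delta => d.
  have := is_deriveM d (is_derive_cst (inner y y) x 'e_j).
  by rewrite scaler0 add0r [_ *: _]mulrC.
have := is_derive_monomial a b (is_derive_innerl x y 'e_j) dw.
rewrite inner_delta => d; apply: is_derive_eq d _.
by rewrite /zmono_dl /zmono; ring.
Qed.

Lemma is_derive_zmonor a b i x y :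
  is_derive y 'e_i (zmono a b x) (zmono_dr a b i x y).
Proof.
have -> : zmono a b x = fun z => zmono a b z x by apply/funext => z; exact: zmonoC.
have := is_derive_zmonol a b i y x.
by rewrite /zmono_dl /zmono_dr ![zmono _ _ y x]zmonoC.
Qed.

Lemma is_derive_zmono_dl a b i j x y :
  is_derive y 'e_i (zmono_dl a b j x) (zmono_d2 a b i j x y).
Proof.
have dj : is_derive y 'e_i (fun z => z 0 j) (i == j)%:R.
  have := is_derive_innerl y 'e_j 'e_i; rewrite inner_delta mxE eqxx eq_sym /=.
  by congr is_derive; apply/funext => z; rewrite innerC inner_delta.
have dq : is_derive y 'e_i (fun z => inner z z) (2 * y 0 i).
  by have := is_derive_innerxx y 'e_i; rewrite (innerC y) inner_delta.
have d1 := is_derive_zmonor a.-1 b i x y.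
have d2 := is_derive_zmonor a b.-1 i x y.
pose coord (z : 'rV[R]_m) : R := z 0 j; pose sq (z : 'rV[R]_m) := inner z z.
have -> : zmono_dl a b j x = a%:R \*: (coord * zmono a.-1 b x)
  + (2 * b%:R * x 0 j) \*: (sq * zmono a b.-1 x).
  by apply/funext => z; rewrite /zmono_dl !fctE /coord /sq -mulrA.
apply: is_derive_eq; rewrite /zmono_d2 /GRing.scale/= /coord /sq; ring.
Qed.

Lemma zmono_s a b x y : inner x y * zmono a b x y = zmono a.+1 b x y.
Proof. by rewrite /zmono exprS mulrA. Qed.

(** The factor b on both sides makes the identity hold for b = 0 as well, where
    the predecessor is not a true predecessor. *)
Lemma zmono_w a b x y :
  b%:R * (inner x x * inner y y * zmono a b.-1 x y) = b%:R * zmono a b x y.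
Proof. by case: b => [|b]; rewrite ?mul0r// /zmono exprS /=; ring. Qed.

Lemma cl_realD (c d : R) : cl_real m (c + d) = cl_real m c + cl_real m d.
Proof. by rewrite /cl_real rmorphD scalerDl. Qed.

Lemma cl_realN (c : R) : cl_real m (- c) = - cl_real m c.
Proof. by rewrite /cl_real rmorphN scaleNr. Qed.

Lemma cl_realZ (r u : R) : r%:C *: cl_real m u = cl_real m (r * u).
Proof. by rewrite /cl_real scalerA -rmorphM. Qed.

(** The five terms are the shapes that a mixed second derivative of a function of
    <x, y> and |x|^2 |y|^2 can take. Contracted with e_j e_i they become - m, y x,
    y y, x y and x x; note that y /\ x = - x /\ y. *)
Lemma sum_cl_gen2 (c1 c2 c3 c4 c5 : R) x y :
  \sum_(i < m) \sum_(j < m) (c1 * (i == j)%:R + c2 * (y 0 j * x 0 i)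
     + c3 * (y 0 j * y 0 i) + c4 * (x 0 j * y 0 i) + c5 * (x 0 j * x 0 i))%:C
    *: (cl_gen R[i] j * cl_gen R[i] i)
  = cl_real m (- (m%:R * c1 + (c2 + c4) * inner x y + c3 * inner y y + c5 * inner x x))
    + (c4 - c2)%:C *: wedge x y.
Proof.
pose L (F : 'I_m -> 'I_m -> R) :=
  \sum_(i < m) \sum_(j < m) (F i j)%:C *: (cl_gen R[i] j * cl_gen R[i] i).
have LD F G : L (fun i j => F i j + G i j) = L F + L G.
  rewrite -big_split; apply: eq_bigr => i _; rewrite -big_split.
  by apply: eq_bigr => j _; rewrite rmorphD scalerDl.
have LM (z t : 'rV[R]_m) (c : R) :
    L (fun i j => c * (z 0 j * t 0 i)) =
    cl_real m (- (c * inner z t)) + c%:C *: wedge z t.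
  rewrite cl_realN /cl_real rmorphM -scalerA addrC -scalerBr -cl_vectorM.
  rewrite /L exchange_big cl_vectorM_sum scaler_sumr.
  apply: eq_bigr => j _; rewrite scaler_sumr; apply: eq_bigr => i _.
  by rewrite rmorphM scalerA.
have Ldelta : L (fun i j => c1 * (i == j)%:R) = cl_real m (- (m%:R * c1)).
  rewrite cl_realN /cl_real /L (eq_bigr (fun=> - c1%:C%:A)) => [|i _].
    by rewrite sumr_const card_ord mulNrn mulr_natl rmorphMn scalerMnl.
  rewrite (bigD1 i)//= big1 ?addr0 => [|j ji].
    by rewrite eqxx mulr1 cl_gen_sqr scalerN.
  by rewrite eq_sym (negbTE ji) mulr0 scale0r.
rewrite -/(L (fun i j => c1 * (i == j)%:R + c2 * (y 0 j * x 0 i)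
     + c3 * (y 0 j * y 0 i) + c4 * (x 0 j * y 0 i) + c5 * (x 0 j * x 0 i))).
rewrite !LD Ldelta !LM !wedgexx (wedgeC x y) (innerC y x) !scaler0 !addr0.
set t1 := - (m%:R * c1); set t2 := - (c2 * _); set t3 := - (c3 * _).
set t4 := - (c4 * _); set t5 := - (c5 * _).
have -> : - (m%:R * c1 + (c2 + c4) * inner x y + c3 * inner y y + c5 * inner x x)
  = t1 + t2 + t3 + t4 + t5 by rewrite /t1 /t2 /t3 /t4 /t5; ring.
have -> : (c4 - c2)%:C *: wedge x y = c4%:C *: wedge x y - c2%:C *: wedge x y.
  by rewrite -scalerBl -rmorphB.
move: t1 t2 t3 t4 t5 => t1 t2 t3 t4 t5.
rewrite !cl_realD (scalerN c2%:C (wedge x y)).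
move: (c2%:C *: wedge x y) (c4%:C *: wedge x y) => B D.
move: (cl_real m t1) (cl_real m t2) (cl_real m t3) (cl_real m t4) (cl_real m t5).
move=> r1 r2 r3 r4 r5.
rewrite !addrA.
by rewrite [LHS](ACl (1 * 2 * 4 * 5 * 7 * 6 * 3))/=.
Qed.

(** The contribution of one monomial s^a w^b. After the contraction, the terms in
    |x|^2 |y|^2 w^(b-1) and <x, y> s^(a-1) are monomials again, which merges all of
    them into two scalar terms and two wedge terms; for instance the coefficient
    4 b^2 is 4 b + 4 b (b - 1). *)
Lemma sum_zmono_d2 a b x y :
  \sum_(i < m) \sum_(j < m)
    (zmono_d2 a b i j x y)%:C *: (cl_gen R[i] j * cl_gen R[i] i)
  = cl_real m (- (a%:R * (m%:R + a.-1%:R + 4 * b%:R) * zmono a.-1 b x y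
                  + 4 * b%:R ^+ 2 * zmono a.+1 b.-1 x y))
    + (4 * b%:R ^+ 2 * zmono a b.-1 x y
       - a%:R * a.-1%:R * zmono a.-2 b x y)%:C *: wedge x y.
Proof.
pose c1 := a%:R * zmono a.-1 b x y.
pose c2 := a%:R * a.-1%:R * zmono a.-2 b x y.
pose c3 := 2 * a%:R * b%:R * inner x x * zmono a.-1 b.-1 x y.
pose c4 := 4 * b%:R ^+ 2 * zmono a b.-1 x y.
pose c5 := 2 * a%:R * b%:R * inner y y * zmono a.-1 b.-1 x y.
have := sum_cl_gen2 c1 c2 c3 c4 c5 x y.
have w1 := zmono_w a.-1 b x y.
have s1 : a%:R * (a.-1%:R * (inner x y * zmono a.-2 b x y)) =
   a%:R * (a.-1%:R * zmono a.-1 b x y).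
  by case: a {c1 c2 c3 c4 c5 w1} => [|[|a]]; rewrite ?mul0r ?mulr0// zmono_s.
have bb : b%:R * b.-1%:R = b%:R ^+ 2 - b%:R :> R.
  case: b {c1 c2 c3 c4 c5 w1 s1} => [|b]; rewrite ?mul0r ?expr0n ?subrr//.
  by rewrite -natr1; ring.
have w2 : b%:R * (b.-1%:R * (inner x x * inner y y * zmono a b.-2 x y)) =
   (b%:R ^+ 2 - b%:R) * zmono a b.-1 x y by rewrite zmono_w mulrA bb.
have -> : - (m%:R * c1 + (c2 + c4) * inner x y + c3 * inner y y + c5 * inner x x)
   = - (a%:R * (m%:R + a.-1%:R + 4 * b%:R) * zmono a.-1 b x y
                  + 4 * b%:R ^+ 2 * zmono a.+1 b.-1 x y).
  rewrite /c1 /c2 /c3 /c4 /c5 -zmono_s; ring: w1 s1.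
move=> <-; apply: eq_bigr => i _; apply: eq_bigr => j _; congr (_%:C *: _).
rewrite /zmono_d2 /zmono_dr /c1 /c2 /c3 /c4 /c5; ring: w2.
Qed.

End ZonalMonomials.

(** * Gegenbauer coefficients *)

Section Coefficients.
Context {R : realType}.
Implicit Types (mu : R) (i j n : nat).

(** The Pochhammer symbol (mu)_n = mu (mu + 1) ... (mu + n - 1). *)
Definition rising mu n : R := \prod_(i < n) (mu + i%:R).

Lemma risingS mu n : rising mu n.+1 = rising mu n * (mu + n%:R).
Proof. by rewrite /rising big_ord_recr. Qed.

Lemma risingSl mu n : rising mu n.+1 = mu * rising (mu + 1) n.
Proof.
rewrite /rising big_ord_recl addr0; congr (_ * _); apply: eq_bigr => i _.
by rewrite /= /bump/= natrD addrA.
Qed.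

Lemma Gamma_rising mu n : 0 < mu -> Gamma (n%:R + mu) = rising mu n * Gamma mu.
Proof.
move=> mu0; elim: n => [|n IHn]; first by rewrite /rising big_ord0 add0r mul1r.
rewrite -natr1 addrAC GammaS ?ltr_wpDl// IHn risingS; ring.
Qed.

(** The coefficient of s^i w^j in |x|^n |y|^n C_n^mu for n = i + 2 j. Indexing by the
    two exponents instead of n and j keeps truncated subtractions out of the
    relations between coefficients. *)
Definition geg_coef mu i j : R :=
  (-1) ^+ j * rising mu (i + j) / (j`!%:R * i`!%:R) * 2 ^+ i.

Let fact_neq0 n : n`!%:R != 0 :> R.
Proof. by rewrite pnatr_eq0 -lt0n fact_gt0. Qed.

(** Coefficientwise form of G_ss - 4 (G_w + w G_ww) = 4 mu (mu + n) G', where G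
    belongs to (mu, n) with n = i + 2 j + 2, and G' to (mu + 1, n - 2). All three
    terms share the factor (mu)_(i+j+1), and what remains is
    (mu + i + j + 1) + (j + 1) = mu + n. *)
Lemma geg_coef_raise mu i j :
  i.+2%:R * i.+1%:R * geg_coef mu i.+2 j - 4 * j.+1%:R ^+ 2 * geg_coef mu i j.+1
  = 4 * mu * (mu + (i + j.*2 + 2)%:R) * geg_coef (mu + 1) i j.
Proof.
rewrite /geg_coef addnS !addSn risingS !risingSl !factS !natrM !exprS -muln2.
have := (fact_neq0 i, fact_neq0 j,
         pnatr_eq0 R i.+1, pnatr_eq0 R i.+2, pnatr_eq0 R j.+1).
rewrite -!natr1 !natrD natrM => -[[[[]]]] hi hj /negbT h1 /negbT h2 /negbT h3.
by field; rewrite hi hj h1 h2 h3.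
Qed.

(** Coefficientwise form of
      s G_ss + 4 w G_sw + (2 mu + 2) G_s + 4 s (G_w + w G_ww)
      = 2 (mu + n) (2 mu + n - 1) G',
    where G belongs to (mu, n) with n = i + 2 j + 1, and G' to (mu, n - 1). The
    second term on the left comes from s^(i-1) w^(j+1), hence is absent for i = 0. *)
Lemma geg_coef_lower mu i j :
  i.+1%:R * (2 * mu + 2 + i%:R + 4 * j%:R) * geg_coef mu i.+1 j
  + (if i is i'.+1 then 4 * j.+1%:R ^+ 2 * geg_coef mu i' j.+1 else 0)
  = 2 * (mu + (i + j.*2 + 1)%:R) * (2 * mu + (i + j.*2)%:R) * geg_coef mu i j.
Proof.
have := (fact_neq0 j, pnatr_eq0 R j.+1); rewrite -natr1 => -[hj /negbT h3].
case: i => [|i].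
  rewrite /geg_coef !add0n add1n risingS factS fact0 mul1n -muln2 !natrD natrM.
  by field; rewrite hj.
rewrite /geg_coef addnS !addSn !risingS !factS !natrM !exprS -muln2.
have := (fact_neq0 i, pnatr_eq0 R i.+1, pnatr_eq0 R i.+2).
rewrite -!natr1 !natrD natrM => -[[]] hi /negbT h1 /negbT h2.
by field; rewrite hi hj h1 h2 h3.
Qed.

End Coefficients.

(** * The zonal functions as polynomials *)

Section Zonal.
Context {R : realType} {m : nat}.
Implicit Types (mu : R) (x y : 'rV[R]_m) (n N : nat).

Lemma inner_ge0 x : 0 <= inner x x.
Proof. by apply: sumr_ge0 => j _; rewrite -expr2 sqr_ge0. Qed.

Lemma enorm_sqr x : enorm x ^+ 2 = inner x x.
Proof. by rewrite sqr_sqrtr ?inner_ge0. Qed.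

Lemma enorm_eq0_inner x y : enorm x = 0 -> inner x y = 0.
Proof.
move=> x0; have : inner x x = 0 by rewrite -enorm_sqr x0 expr0n.
move/eqP; rewrite psumr_eq0 => [/allP xx0|j _]; last by rewrite -expr2 sqr_ge0.
apply: big1 => j _; have := xx0 j (mem_index_enum j).
by rewrite /= mulf_eq0 orbb => /eqP ->; rewrite mul0r.
Qed.

(** The point is that r^i (s / r)^i = s^i for r = |x| |y| and s = <x, y>, even when
    r = 0: then s = 0, and both sides are 0^i. The bound N is free so that sums of different
    degrees can be compared over a common range. *)
Lemma zonalE mu n N x y : 0 < mu -> (n./2 < N)%N ->
  zonal mu n x y =
  \sum_(j < N | (j.*2 <= n)%N) geg_coef mu (n - j.*2) j * zmono (n - j.*2) j x y.
Proof.
move=> mu0 nN; have G0 := Gamma_gt0 mu mu0.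
rewrite /zonal /= -exprMn.
set r := enorm x * enorm y; rewrite mulr_sumr.
rewrite (big_ord_widen _ (fun j => r ^+ n * ((-1) ^+ j
  * (Gamma ((n - j)%:R + mu) / (Gamma mu * j`!%:R * (n - j.*2)`!%:R))
  * (2 * (inner x y / r)) ^+ (n - j.*2))) nN).
apply: eq_big => [j|j jn]; first by rewrite /= ltnS geq_half_double.
rewrite ltnS geq_half_double in jn.
have -> : (n - j = (n - j.*2) + j)%N by lia.
rewrite Gamma_rising//; move: {jn} (n - j.*2)%N (subnK jn) => i <-.
have rE : r ^+ 2 = inner x x * inner y y by rewrite exprMn !enorm_sqr.
have rs : r ^+ i * (inner x y / r) ^+ i = inner x y ^+ i.
  rewrite -exprMn; have [r0|r0] := eqVneq r 0; last by rewrite mulrC divfK.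
  move/eqP : (r0); rewrite mulf_eq0 => /orP[] /eqP z0; rewrite r0 mul0r.
    by rewrite enorm_eq0_inner.
  by rewrite innerC enorm_eq0_inner.
rewrite /zmono -rE -exprM mul2n exprD -rs /geg_coef [(2 * _) ^+ i]exprMn.
have j0 : j`!%:R != 0 :> R by rewrite pnatr_eq0 -lt0n fact_gt0.
have i0 : i`!%:R != 0 :> R by rewrite pnatr_eq0 -lt0n fact_gt0.
by field; rewrite j0 i0 gt_eqF.
Qed.

End Zonal.

(** * The Dirac operators on zonal polynomials *)

Section ZonalCombinations.
Context {R : realType} {m : nat}.
Implicit Types (mu : R) (x y : 'rV[R]_m).

Lemma is_derive_lincomb {V : normedModType R} {N : nat} (c : 'I_N -> R)
    (f : 'I_N -> V -> R) (df : 'I_N -> R) (x v : V) :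
  (forall l, is_derive x v (f l) (df l)) ->
  is_derive x v (fun z => \sum_(l < N) c l * f l z) (\sum_(l < N) c l * df l).
Proof.
move=> fd; have -> : (fun z => \sum_(l < N) c l * f l z) = \sum_(l < N) c l \*: f l.
  by apply/funext => z; rewrite fct_sumE.
exact: is_derive_sum.
Qed.

Lemma dirac_zmono_lincomb N (c : 'I_N -> R) (a b : 'I_N -> nat) x y :
  dirac_right (fun y' => dirac_left (fun x' =>
    cl_real m (\sum_(l < N) c l * zmono (a l) (b l) x' y')) x) y
  = cl_real m (- \sum_(l < N) c l *
      ((a l)%:R * (m%:R + (a l).-1%:R + 4 * (b l)%:R) * zmono (a l).-1 (b l) x y
       + 4 * (b l)%:R ^+ 2 * zmono (a l).+1 (b l).-1 x y))
    + (\sum_(l < N) c l * (4 * (b l)%:R ^+ 2 * zmono (a l) (b l).-1 x y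
       - (a l)%:R * (a l).-1%:R * zmono (a l).-2 (b l) x y))%:C *: wedge x y.
Proof.
pose K (x' y' : 'rV[R]_m) := \sum_(l < N) c l * zmono (a l) (b l) x' y'.
pose D j (x' y' : 'rV[R]_m) := \sum_(l < N) c l * zmono_dl (a l) (b l) j x' y'.
have KD j y' : is_derive x 'e_j (fun x' => K x' y') (D j x y').
  apply: (@is_derive_lincomb _ _ _ (fun l z => zmono (a l) (b l) z y')) => l.
  exact: is_derive_zmonol.
have DH i j : is_derive y 'e_i (D j x)
    (\sum_(l < N) c l * zmono_d2 (a l) (b l) i j x y).
  by apply: is_derive_lincomb => l; exact: is_derive_zmono_dl.
rewrite (dirac_left_right K D _ x y KD DH).
have -> : \sum_(i < m) \sum_(j < m)
    (\sum_(l < N) c l * zmono_d2 (a l) (b l) i j x y)%:C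
      *: (cl_gen R[i] j * cl_gen R[i] i)
  = \sum_(l < N) (c l)%:C *: \sum_(i < m) \sum_(j < m)
    (zmono_d2 (a l) (b l) i j x y)%:C *: (cl_gen R[i] j * cl_gen R[i] i).
  under [RHS]eq_bigr do rewrite scaler_sumr.
  rewrite [RHS]exchange_big; apply: eq_bigr => i _ /=.
  under [RHS]eq_bigr do rewrite scaler_sumr.
  rewrite [RHS]exchange_big; apply: eq_bigr => j _ /=.
  rewrite rmorph_sum scaler_suml; apply: eq_bigr => l _.
  by rewrite rmorphM scalerA.
rewrite -sumrN rmorph_sum scaler_suml /cl_real rmorph_sum scaler_suml -big_split.
apply: eq_bigr => l _; rewrite sum_zmono_d2 scalerDr /cl_real !scalerA -!rmorphM.
by rewrite mulrN.
Qed.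

(** Applying the operators to the l-th monomial of degree n yields two monomials:
    one with the same exponent l of w, and one with exponent l - 1. This collects
    the two contributions to exponent j. *)
Lemma sum_collect_shift (n N : nat) (A B : nat -> R) : B 0 = 0 -> (n./2 < N)%N ->
  \sum_(l < N.+1 | (l.*2 <= n)%N) (A l + B l) =
  \sum_(j < N) ((if (j.*2 <= n)%N then A j else 0)
                + (if (j.+1.*2 <= n)%N then B j.+1 else 0)).
Proof.
move=> B0 nN; rewrite !big_split/=; congr (_ + _).
  by rewrite big_mkcond big_ord_recr/= -geq_half_double leqNgt nN addr0.
by rewrite big_mkcond big_ord_recl/= B0 add0r.
Qed.

Lemma scalar_part_zonal mu k x y :
  \sum_(l < k.+2 | (l.*2 <= k.+1)%N) geg_coef mu (k.+1 - l.*2) l *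
    ((k.+1 - l.*2)%:R * (2 * mu + 2 + (k.+1 - l.*2).-1%:R + 4 * l%:R)
       * zmono (k.+1 - l.*2).-1 l x y
     + 4 * l%:R ^+ 2 * zmono (k.+1 - l.*2).+1 l.-1 x y)
  = 2 * (mu + k.+1%:R) * (2 * mu + k%:R) *
    \sum_(j < k.+1 | (j.*2 <= k)%N) geg_coef mu (k - j.*2) j * zmono (k - j.*2) j x y.
Proof.
under eq_bigr do rewrite mulrDr.
rewrite (@sum_collect_shift _ _
  (fun l => geg_coef mu (k.+1 - l.*2) l * ((k.+1 - l.*2)%:R
     * (2 * mu + 2 + (k.+1 - l.*2).-1%:R + 4 * l%:R) * zmono (k.+1 - l.*2).-1 l x y))
  (fun l => geg_coef mu (k.+1 - l.*2) l
     * (4 * l%:R ^+ 2 * zmono (k.+1 - l.*2).+1 l.-1 x y))); last 2 first.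
- by rewrite expr0n mulr0 mul0r mulr0.
- by rewrite ltn_half_double; lia.
rewrite [in RHS]big_mkcond mulr_sumr; apply: eq_bigr => j _.
(* For 2 j = k + 1 the derivative in s kills the last monomial, w^j. *)
have [jk|kj] := leqP j.*2 k; last first.
  rewrite (_ : (j.+1.*2 <= k.+1)%N = false) 1?mulr0 ?addr0; last by lia.
  case: leqP => // jk; rewrite (_ : k.+1 - j.*2 = 0)%N ?mul0r ?mulr0//; lia.
rewrite leqW// doubleS.
have := geg_coef_lower mu (k - j.*2) j.
have -> : (k.+1 - j.*2 = (k - j.*2).+1)%N by lia.
have -> : (k.+1 - j.*2.+2 = (k - j.*2).-1)%N by lia.
have -> : (j.*2.+2 <= k.+1)%N = (0 < k - j.*2)%N by lia.
have -> : (k - j.*2 + j.*2 + 1 = k.+1)%N by lia.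
have -> : (k - j.*2 + j.*2 = k)%N by lia.
rewrite [_.+1.-1]/= => E.
rewrite [RHS]mulrA -E; case: (k - j.*2)%N => [|i] /=; ring.
Qed.

Lemma wedge_part_zonal mu k x y :
  \sum_(l < k.+3 | (l.*2 <= k.+2)%N) geg_coef mu (k.+2 - l.*2) l *
    (4 * l%:R ^+ 2 * zmono (k.+2 - l.*2) l.-1 x y
     - (k.+2 - l.*2)%:R * (k.+2 - l.*2).-1%:R * zmono (k.+2 - l.*2).-2 l x y)
  = - (4 * mu * (mu + k.+2%:R) *
    \sum_(j < k.+2 | (j.*2 <= k)%N)
      geg_coef (mu + 1) (k - j.*2) j * zmono (k - j.*2) j x y).
Proof.
under eq_bigr do rewrite mulrBr addrC.
rewrite (@sum_collect_shift _ _
  (fun l => - (geg_coef mu (k.+2 - l.*2) l * ((k.+2 - l.*2)%:R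
     * (k.+2 - l.*2).-1%:R * zmono (k.+2 - l.*2).-2 l x y)))
  (fun l => geg_coef mu (k.+2 - l.*2) l
     * (4 * l%:R ^+ 2 * zmono (k.+2 - l.*2) l.-1 x y))); last 2 first.
- by rewrite expr0n mulr0 mul0r mulr0.
- by rewrite ltn_half_double; lia.
rewrite [in RHS]big_mkcond mulr_sumr -sumrN; apply: eq_bigr => j _.
(* For 2 j = k + 1 and 2 j = k + 2 the second derivative in s is zero. *)
rewrite doubleS !ltnS; have [jk|kj] := leqP j.*2 k; last first.
  rewrite mulr0 oppr0 addr0; case: leqP => // jk.
  have -> : (k.+2 - j.*2).-1 = 0%N by lia.
  by rewrite mulr0 mul0r mulr0 oppr0.
rewrite leqW ?leqW//.
have := geg_coef_raise mu (k - j.*2) j.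
have -> : (k.+2 - j.*2 = (k - j.*2).+2)%N by lia.
have -> : (k - j.*2 + j.*2 + 2 = k.+2)%N by lia.
rewrite subSS subSS /= => E.
rewrite [X in _ = - X]mulrA -E; ring.
Qed.

End ZonalCombinations.

Theorem theorem3p2 (R : realType) (m k : nat) (hm : (3 <= m)%N)
    (x y : 'rV[R]_m) :
  let mu : R := m%:R / 2 - 1 in
  dirac_right
    (fun y' => dirac_left
       (fun x' => cl_real m (harmonic_kernel k.+1 x' y')) x) y
  = - (((m%:R + 2 * k%:R) ^+ 2 : R)%:C *:
        (cl_real m ((2 * mu + k%:R) / (2 * mu) * zonal mu k x y)
         + (zonal (mu + 1) (k%:Z - 1) x y)%:C *: wedge x y)).
Proof.
move=> mu.
have mu0 : 0 < mu.
  have : 3%:R <= m%:R :> R by rewrite ler_nat.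
  by rewrite /mu; lra.
have mE : m%:R = 2 * mu + 2 by rewrite /mu; field.
(* Zero coefficients beyond l = (k + 1) / 2 turn the kernel into an unconditional
   sum of monomials. *)
pose c (l : 'I_k.+2) := (k.+1%:R + mu) / mu *
  (if (l.*2 <= k.+1)%N then geg_coef mu (k.+1 - l.*2) l else 0).
have KE (x' y' : 'rV[R]_m) : harmonic_kernel k.+1 x' y' =
    \sum_(l < k.+2) c l * zmono (k.+1 - l.*2) l x' y'.
  rewrite /harmonic_kernel -/mu (@zonalE _ _ mu k.+1 k.+2)//; last by lia.
  rewrite mulr_sumr big_mkcond; apply: eq_bigr => l _; rewrite /c.
  by case: ifP; rewrite ?mulr0 ?mul0r// mulrA.
under [in LHS]eq_fun do under eq_fun do rewrite KE.
rewrite (@dirac_zmono_lincomb _ _ _ c (fun l => (k.+1 - l.*2)%N) (fun l => l : nat)).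
have cE (F : 'I_k.+2 -> R) : \sum_(l < k.+2) c l * F l =
   (k.+1%:R + mu) / mu *
   \sum_(l < k.+2 | (l.*2 <= k.+1)%N) geg_coef mu (k.+1 - l.*2) l * F l.
  rewrite mulr_sumr [RHS]big_mkcond; apply: eq_bigr => l _; rewrite /c.
  by case: ifP; rewrite ?mulr0 ?mul0r// mulrA.
rewrite !cE mE scalar_part_zonal.
rewrite -(@zonalE _ _ mu k k.+1)//; last by lia.
rewrite scalerDr opprD; congr (_ + _).
  rewrite cl_realZ -[RHS]cl_realN; congr (cl_real m (- _)).
  by rewrite -natr1; field; rewrite gt_eqF.
rewrite scalerA -[RHS]scaleNr -rmorphM -rmorphN; congr (_%:C *: _).
have mu10 : 0 < mu + 1 by lra.
(* For k = 0 the zonal function on the right has degree -1, so it is 0 by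
   convention; on the left the only monomial is <x, y>, without wedge part. *)
case: k c KE cE => [|k] c KE cE.
  rewrite [zonal _ _ _ _]mulr0 mulr0 oppr0 big_mkcond !big_ord_recl big_ord0 /=.
  by rewrite expr0n/= !(mulr0, mul0r, subr0, addr0).
have -> : k.+1%:Z - 1 = k%:Z by rewrite -addn1 PoszD addrK.
rewrite wedge_part_zonal -(@zonalE _ _ (mu + 1) k k.+2)//; last by lia.
by rewrite -!natr1; field; rewrite gt_eqF.
Qed.
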